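(* Let $P:\mathscr X\to\mathscr Y$ be affine and let $\Lambda=\bigcup_{i=1}^p\Lambda_i$ be the union of finitely many convex polyhedral sets $\Lambda_i=\{y\in\mathscr Y:\langle\lambda_{ij},y\rangle\le b_{ij},\ j=1,\dots,m_i\}$, where $\lambda_{ij}\in\mathscr Y$ and $b_{ij}\in\mathbb R$ for $i=1,\dots,p$, $j=1,\dots,m_i$. Then for any feasible point $\bar x$, i.e., any $\bar x$ satisfying $P(\bar x)\in\Lambda$, pseudo-normality holds at $\bar x$.
   Context: $\mathscr X,\mathscr Y$ are finite-dimensional Hilbert spaces. For a set $\Omega\subseteq\mathscr Y$ and $\bar y\in\Omega$, the regular normal cone is $\widehat N_\Omega(\bar y)=\{\zeta:\limsup_{y\to\bar y,\,y\in\Omega}\langle\zeta,y-\bar y\rangle/\|y-\bar y\|\le0\}$ and the limiting normal cone is $N_\Omega(\bar y)=\{\zeta:\exists\, y_k\to\bar y,\ y_k\in\Omega,\ \zeta_k\to\zeta\text{ with }\zeta_k\in\widehat N_\Omega(y_k)\ \forall k\}$; both are empty at points outside $\Omega$. For $P$ continuously differentiable at $\bar x$ with $P(\bar x)\in\Lambda$, pseudo-normality holds at $\bar x$ if there exists no $\zeta\neq0$ such that $0=\nabla P(\bar x)^*\zeta$, $\zeta\in N_\Lambda(P(\bar x))$, and there exist $(x^k,s^k,\zeta^k)\to(\bar x,P(\bar x),\zeta)$ such that for all $k$, $\zeta^k\in N_\Lambda(s^k)$ and $\langle\zeta,P(x^k)-s^k\rangle>0$. Here $\nabla P(\bar x)^*$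 is the adjoint of the Fréchet derivative $\nabla P(\bar x)$. *)

(* Defs.v *)
From HB Require Import structures.
From mathcomp Require Import all_boot all_order all_algebra.
From mathcomp Require Import all_classical all_reals all_analysis.
From mathcomp Require Import ring.

Set Implicit Arguments.
Unset Strict Implicit.
Unset Printing Implicit Defensive.

Import Order.TTheory GRing.Theory Num.Theory.
Import numFieldNormedType.Exports.

Local Open Scope classical_set_scope.
Local Open Scope ring_scope.

(* A finite-dimensional real Hilbert space is a normed space of finite
   dimension (Vector) whose norm is induced by a positive definite symmetric
   bilinear form; completeness is automatic in finite dimension. *)
HB.mixin Record NormedVector_isHilbert (R : realType) V
    of NormedModule R V & Vector R V := {
  inner : {dot V for (@idfun R)} ;
  inner_normE : forall x : V, inner x x = `|x| ^+ 2
}.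

#[short(type="finHilbertType")]
HB.structure Definition FinHilbert (R : realType) :=
  { V of NormedModule R V & Vector R V & NormedVector_isHilbert R V }.

Section Definitions.
Context {R : realType} {X Y : finHilbertType R}.

Definition adjoint (f : X -> Y) (zeta : Y) : X :=
  get [set v : X | forall x, inner (f x) zeta = inner x v].

Definition affine_map (P : X -> Y) : Prop :=
  exists (A : {linear X -> Y}) (c : Y), forall x, P x = A x + c.

Definition polyhedron (m : nat) (lambda : 'I_m -> Y) (b : 'I_m -> R) : set Y :=
  [set y | forall j, inner (lambda j) y <= b j].

(* The upper limit is over y != ybar in Omega; at an isolated point of Omega it
   is -oo, so that the cone is then the whole space. *)
Definition regular_normal_cone (Omega : set Y) (ybar : Y) : set Y :=
  [set zeta | Omega ybar /\
    (limf_esup (fun y => (inner zeta (y - ybar) / `|y - ybar|)%:E)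
       (within Omega ybar^') <= 0)%E].

Definition limiting_normal_cone (Omega : set Y) (ybar : Y) : set Y :=
  [set zeta | Omega ybar /\
    exists y z : nat -> Y,
      [/\ y @ \oo --> ybar, z @ \oo --> zeta &
          forall k, Omega (y k) /\ regular_normal_cone Omega (y k) (z k)]].

(* To be used for P continuously differentiable at xbar with P xbar in Lambda;
   'd P xbar is the Frechet derivative of P at xbar. *)
Definition pseudo_normality (P : X -> Y) (Lambda : set Y) (xbar : X) : Prop :=
  ~ exists zeta : Y,
      [/\ zeta != 0,
          adjoint ('d P xbar) zeta = 0,
          limiting_normal_cone Lambda (P xbar) zeta &
          exists (x : nat -> X) (s z : nat -> Y),
            [/\ x @ \oo --> xbar, s @ \oo --> P xbar, z @ \oo --> zeta &
                forall k, limiting_normal_cone Lambda (s k) (z k) /\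
                          0 < inner zeta (P (x k) - s k)]].

End Definitions.

Section InnerTheory.
Context {R : realType} {X : finHilbertType R}.

Lemma inner_eq0 (v : X) : inner v v = 0 -> v = 0.
Proof. by rewrite inner_normE => /eqP; rewrite expf_eq0/= normr_eq0 => /eqP. Qed.

Lemma innerC (u v : X) : inner u v = inner v u.
Proof. by rewrite [LHS](hermC (inner : {dot X for idfun})) expr0 mul1r. Qed.

Lemma polarization (u v : X) :
  inner u v = (`|u + v| ^+ 2 - `|u - v| ^+ 2) / 4.
Proof.
rewrite -!inner_normE !linearDl !linearDr/= !linearNl !linearNr/= [inner v u]innerC.
by field.
Qed.

Lemma riesz (g : {linear X -> R^o}) : exists v : X, forall x, g x = inner x v.
Proof.
pose F (v : X) : 'Hom(X, R^o) := linfun (inner v : X -> R^o).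
have FE v x : F v x = inner x v by rewrite lfunE /= innerC.
have Flin : linear F.
  move=> a u v; apply/lfunP => x.
  by rewrite add_lfunE scale_lfunE !FE linearP.
pose FL := GRing.isLinear.Build _ _ _ _ F Flin.
pose F' : {linear X -> 'Hom(X, R^o)} := HB.pack F FL.
have inj : lker (linfun F') == 0%VS.
  rewrite -subv0; apply/subvP => v; rewrite memv_ker lfunE/= => /eqP Fv0.
  by rewrite memv0; apply/eqP/inner_eq0; rewrite -FE Fv0 lfunE.
have full : limg (linfun F') = fullv.
  apply/eqP; rewrite eqEdim subvf/= limg_dim_eq.
    by rewrite !dimvf /dim/= /dim/= muln1.
  by move: inj => /eqP ->; rewrite capv0.
have := memvf (linfun g); rewrite -full => /memv_imgP[v _ gv].
exists v => x; rewrite -FE.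
have -> : F v = linfun F' v by rewrite lfunE.
by rewrite -gv lfunE.
Qed.

Lemma continuous_inner (v : X) : continuous (fun x : X => inner x v).
Proof.
have -> : (fun x : X => inner x v) =
    (fun x => (`|x + v| * `|x + v| - `|x - v| * `|x - v|) / 4).
  by apply/funext => x; rewrite polarization !expr2.
move=> x; apply: cvgMr_tmp; apply: cvgB; apply: cvgM; apply: cvg_norm;
  by [apply: cvgD => //; exact: cvg_cst | apply: cvgB => //; exact: cvg_cst].
Qed.

End InnerTheory.

Section WellDefinedness.
Context {R : realType} {X Y : finHilbertType R}.

Lemma adjointP (f : {linear X -> Y}) (zeta : Y) (x : X) :
  inner (f x) zeta = inner x (adjoint f zeta).
Proof.
have glin : linear (fun x : X => inner zeta (f x) : R^o).
  by move=> a u v; rewrite !linearP.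
pose G := GRing.isLinear.Build _ _ _ _ _ glin.
have [v gv] := riesz (HB.pack (fun x : X => inner zeta (f x) : R^o) G).
rewrite /adjoint; case: xgetP => [w _ /(_ x)//|/(_ v)[]].
by move=> y; rewrite innerC; exact: gv.
Qed.

Lemma linear_continuous (A : {linear X -> Y}) : continuous A.
Proof.
pose e := vbasis {:X}.
have coordc i : continuous (fun x : X => coord e i x : R).
  have l : linear (fun x : X => coord e i x : R^o).
    by move=> a u v; rewrite linearP.
  pose G := GRing.isLinear.Build _ _ _ _ _ l.
  have [v gv] := riesz (HB.pack (fun x : X => coord e i x : R^o) G).
  have -> : (fun x : X => coord e i x : R) = (fun x => inner x v).
    by apply/funext => x; exact: gv.
  exact: continuous_inner.
have -> : (A : X -> Y) = \sum_i (fun x => coord e i x *: A e`_i).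
  apply/funext => x; rewrite {1}(coord_vbasis (memvf x)) linear_sum fct_sumE.
  by apply: eq_bigr => i _; rewrite linearZ.
elim/big_ind: _ => [x|f g fc gc x|i _ x]; first exact: cvg_cst.
  by apply: cvgD; [exact: fc | exact: gc].
by apply: cvgZr_tmp; exact: coordc.
Qed.

Lemma affine_is_diff (P : X -> Y) (A : {linear X -> Y}) (c : Y) (x : X) :
  (forall u, P u = A u + c) -> is_diff x P A.
Proof.
move=> PE.
have -> : P = (A : X -> Y) + cst c by apply/funext => u; rewrite PE.
have h := linear_differentiable x (@linear_continuous A).
apply: DiffDef; first exact: differentiableD.
rewrite diffD// (diff_lin _ (@linear_continuous A)) diff_cst; apply/funext => u; exact: addr0.
Qed.

End WellDefinedness.

(* Main.v *)
Require Import Defs.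
From mathcomp Require Import all_boot all_order all_algebra.
From mathcomp Require Import all_classical all_reals all_analysis.

(* A limiting normal of the union Lambda at s is polar to the tangent cone at s
   of one of the pieces containing s, and that tangent cone depends only on the
   set J of active constraints of the piece. Along a sequence s^k -> P xbar some
   piece i and active set J occur infinitely often. For such a k, P xbar lies in
   Lambda_i by closedness, so P xbar - s^k lies in the tangent cone given by J,
   and the inequality <zeta^l, P xbar - s^k> <= 0, valid for infinitely many l,
   passes to the limit zeta. As the range of the linear part of P is orthogonal
   to zeta, <zeta, P x^k - s^k> = <zeta, P xbar - s^k> <= 0. *)

Set Implicit Arguments.
Unset Strict Implicit.
Unset Printing Implicit Defensive.

Import Order.TTheory GRing.Theory Num.Theory.
Import numFieldNormedType.Exports.

Local Open Scope classical_set_scope.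
Local Open Scope ring_scope.

Lemma infinite_pigeonhole (T : finType) (Q : T -> nat -> Prop) :
  (forall n, exists t, Q t n) ->
  exists t, forall N, exists2 n, (N <= n)%N & Q t n.
Proof.
move=> exQ; apply: contrapT => noinf.
have bound t : exists N, forall n, (N <= n)%N -> ~ Q t n.
  apply: contrapT => noN; apply: noinf; exists t => N.
  apply: contrapT => non; apply: noN; exists N => n Nn Qtn.
  by apply: non; exists n.
have [N NP] := choice bound.
have [t Qt] := exQ (\max_t N t)%N.
exact: (NP t _ (leq_bigmax t)).
Qed.

Lemma frequently_le_lim (R : realType) (u : nat -> R) (a c : R) :
  u @ \oo --> a -> (forall N, exists2 n, (N <= n)%N & u n <= c) -> a <= c.
Proof.
move=> ua freq; rewrite leNgt; apply/negP => ca.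
have [N _ NP] := cvgr_gt _ ua _ ca.
have [n Nn unc] := freq N.
by have := NP n Nn; rewrite /= ltNge unc.
Qed.

Section FeasibleDirections.
Context {R : realType} {Y : finHilbertType R}.

Lemma inner_continuous_r (v : Y) : continuous (fun y : Y => inner v y).
Proof.
have -> : (fun y : Y => inner v y) = (fun y => inner y v).
  by apply/funext => y; rewrite innerC.
exact: continuous_inner.
Qed.

Definition active (m : nat) (lambda : 'I_m -> Y) (b : 'I_m -> R) (y : Y) :
    {set 'I_m} :=
  [set j | inner (lambda j) y == b j]%SET.

(** When [J] is the active set at a point of the polyhedron, this is the tangent cone there. Taking
    [J] as a parameter lets one cone serve all points with the same active set. *)
Definition active_cone (m : nat) (lambda : 'I_m -> Y) (J : {set 'I_m}) : set Y :=
  [set d | forall j, j \in J -> inner (lambda j) d <= 0].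

(** By continuity, a constraint that is slack or violated at [s] remains so at all nearby points. *)
Lemma near_active (m : nat) (lambda : 'I_m -> Y) (b : 'I_m -> R) (s : Y) :
  \forall y \near s, active lambda b y \subset active lambda b s.
Proof.
have : \forall y \near s, forall j, j \in active lambda b y ->
    j \in active lambda b s.
  apply: filter_forall => j; rewrite inE.
  have [sj|/eqP sj] := eqVneq (inner (lambda j) s) (b j); first by near=> y.
  have [lt|lt|//] := ltgtP (inner (lambda j) s) (b j).
    have : \forall y \near s, inner (lambda j) y < b j.
      exact: (cvgr_lt _ (@inner_continuous_r (lambda j) s)).
    by apply: filterS => y ylt; rewrite inE (lt_eqF ylt).
  have : \forall y \near s, inner (lambda j) y > b j.
    exact: (cvgr_gt _ (@inner_continuous_r (lambda j) s)).
  by apply: filterS => y ylt; rewrite inE (gt_eqF ylt).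
by apply: filterS => y yP; apply/fintype.subsetP.
Unshelve. all: by end_near. Qed.

Lemma ray_cvg (y d : Y) : (fun t : R => y + t *: d) t @[t --> 0^'+] --> y.
Proof.
rewrite -[X in _ --> X]addr0 -[X in _ --> _ + X](scale0r d).
apply: cvgD; first exact: cvg_cst.
by apply: cvgZr_tmp; apply: cvg_within.
Qed.

(** Along [d] the active constraints do not increase, and the inactive ones have slack that a small
    step does not use up. *)
Lemma polyhedron_feasible (m : nat) (lambda : 'I_m -> Y) (b : 'I_m -> R)
    (y d : Y) :
  polyhedron lambda b y -> active_cone lambda (active lambda b y) d ->
  \forall t \near (0 : R)^'+, polyhedron lambda b (y + t *: d).
Proof.
move=> py dy; apply: filter_forall => j.
have [yj|yj] := eqVneq (inner (lambda j) y) (b j).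
  near=> t; rewrite linearD linearZ /= yj gerDl mulr_ge0_le0//.
  by apply: dy; rewrite inE yj.
have ltb : inner (lambda j) y < b j by rewrite lt_neqAle yj py.
have : \forall t \near (0 : R)^'+, inner (lambda j) (y + t *: d) < b j.
  apply: (cvgr_lt (inner (lambda j) y)) => //.
  exact: (cvg_comp _ _ (@ray_cvg y d) (@inner_continuous_r (lambda j) y)).
by apply: filterS => t /ltW.
Unshelve. all: by end_near. Qed.

(** Along the ray from [y] the difference quotient is constant, equal to [inner z d / |d|]; were it
    positive, it would bound the upper limit away from 0. *)
Lemma regular_normal_feasible (Omega : set Y) (y z d : Y) :
  regular_normal_cone Omega y z ->
  (\forall t \near (0 : R)^'+, Omega (y + t *: d)) -> inner z d <= 0.
Proof.
move=> [_ supz] feas; rewrite leNgt; apply/negP => zd.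
have d0 : d != 0 by apply: contraTneq zd => ->; rewrite linear0 ltxx.
have slope : 0 < inner z d / `|d| by rewrite divr_gt0 // normr_gt0.
move: supz; rewrite leNgt => /negP; apply.
apply: (@lt_le_trans _ _ (inner z d / `|d|)%:E); first by rewrite lte_fin.
(* The upper limit is the infimum, over the sets [A] of the filter, of the supremum on [A]; so one
   point of the ray in each [A] is enough. *)
apply: le_ereal_inf_tmp => _ [A FA <-].
have nearA : \forall t \near (0 : R)^'+, A (y + t *: d).
  have FAt : \forall t \near (0 : R)^'+,
      y + t *: d != y -> Omega (y + t *: d) -> A (y + t *: d).
    exact: (@ray_cvg y d [set u | u != y -> Omega u -> A u] FA).
  near=> t; apply: (near FAt t) => //; last exact: (near feas t).
  rewrite -subr_eq0 addrC addKr scaler_eq0 negb_or d0 andbT.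
  by rewrite gt_eqF.
have [t [t0 At]] : exists t : R, 0 < t /\ A (y + t *: d).
  apply: (@filter_ex _ (0 : R)^'+); near=> t; split => //.
  exact: (near nearA t).
apply: ereal_sup_ubound; exists (y + t *: d) => //.
rewrite addrC addKr linearZ /= normrZ gtr0_norm// invfM mulrACA divff ?mul1r//.
by rewrite gt_eqF.
Unshelve. all: by end_near. Qed.

(** Some piece contains infinitely many of the approximating points, and a direction feasible for
    that piece is feasible for the union, so the regular normals at these points are polar to it. *)
Lemma limiting_normal_union_polyhedra (p : nat) (m : 'I_p -> nat)
    (lambda : forall i : 'I_p, 'I_(m i) -> Y)
    (b : forall i : 'I_p, 'I_(m i) -> R) (s z : Y) :
  limiting_normal_cone
    (\bigcup_(i in [set: 'I_p]) polyhedron (lambda i) (b i)) s z ->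
  exists2 i, polyhedron (lambda i) (b i) s &
    forall d, active_cone (lambda i) (active (lambda i) (b i) s) d ->
      inner z d <= 0.
Proof.
move=> [_ [y [w [ys wz yw]]]].
have [n|i freq] := @infinite_pigeonhole _
    (fun i n => polyhedron (lambda i) (b i) (y n)).
  by have [[i _ iy] _] := yw n; exists i.
exists i => [j|d ds].
  apply: (frequently_le_lim
    (cvg_comp _ _ ys (@inner_continuous_r (lambda i j) s))).
  by move=> N; have [n Nn yn] := freq N; exists n => //; exact: yn.
apply: (frequently_le_lim (cvg_comp _ _ wz (@continuous_inner _ _ d z))) => N.
have [M _ MP] := ys _ (near_active (lambda i) (b i) s).
have [n] := freq (maxn N M); rewrite geq_max => /andP[Nn Mn] yn.
exists n => //; apply: (regular_normal_feasible (yw n).2).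
(* Near [s] the active set can only shrink, which enlarges the cone. *)
have dn : active_cone (lambda i) (active (lambda i) (b i) (y n)) d.
  by move=> j jn; apply: ds; apply: (fintype.subsetP (MP n Mn)).
by apply: filterS (polyhedron_feasible yn dn) => t; exists i.
Qed.

End FeasibleDirections.

Theorem proposition4p2 (R : realType) (X Y : finHilbertType R) (P : X -> Y)
    (p : nat) (m : 'I_p -> nat)
    (lambda : forall i : 'I_p, 'I_(m i) -> Y)
    (b : forall i : 'I_p, 'I_(m i) -> R) (Lambda : set Y) (xbar : X) :
  affine_map P ->
  Lambda = \bigcup_(i in [set: 'I_p]) polyhedron (lambda i) (b i) ->
  Lambda (P xbar) ->
  pseudo_normality P Lambda xbar.
Proof.
move=> [A [c PE]] -> _ [zeta [_ adj0 _ [x [s [z [_ sP zzeta sz]]]]]].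
have Pconst u v : inner zeta (P u) = inner zeta (P v).
  have orth w : inner zeta (A w) = 0.
    have dPA : 'd P xbar = A :> (X -> Y).
      by have is_diffP := affine_is_diff xbar PE; exact: diff_val.
    by rewrite innerC adjointP -dPA adj0 linear0.
  by rewrite !PE !linearD /= !orth.
(* A piece paired with a subset of its constraints ranges over a finite type, so a single pigeonhole
   fixes both. *)
pose Q (t : {i : 'I_p & {set 'I_(m i)}}) n :=
  [/\ polyhedron (lambda (tag t)) (b (tag t)) (s n),
      active (lambda (tag t)) (b (tag t)) (s n) = tagged t &
      forall d, active_cone (lambda (tag t)) (tagged t) d -> inner (z n) d <= 0].
have [n|[i J] freq] := @infinite_pigeonhole _ Q.
  have [i si zi] := limiting_normal_union_polyhedra (sz n).1.
  by exists (Tagged (fun i => {set 'I_(m i)}) (active (lambda i) (b i) (s n))).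
have PxbarL : polyhedron (lambda i) (b i) (P xbar).
  move=> j.
  apply: (frequently_le_lim
    (cvg_comp _ _ sP (@inner_continuous_r _ _ (lambda i j) (P xbar)))) => N.
  by have [n Nn [/= sn _ _]] := freq N; exists n => //; exact: sn.
(* Any index satisfying [Q] would do; [k] then stays fixed while the limit of [z] is taken. *)
have [k _ [/= _ skJ _]] := freq 0%N.
(* The constraints in [J] are equalities at [s k] and inequalities at [P xbar]. *)
have dJ : active_cone (lambda i) J (P xbar - s k).
  move=> j; rewrite -skJ inE => /eqP skj.
  by rewrite linearB /= skj subr_le0.
have : inner zeta (P xbar - s k) <= 0.
  apply: (frequently_le_lim
    (cvg_comp _ _ zzeta (@continuous_inner _ _ (P xbar - s k) zeta))) => N.
  by have [n Nn [_ _ zn]] := freq N; exists n => //; exact: zn.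
have := (sz k).2.
by rewrite !linearB /= (Pconst (x k) xbar) ltNge => /negP.
Qed.
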